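(* Suppose there are a nonnegative function $\Psi\in C([0,\infty))\cap C^2((0,\infty))$ with $\Psi(0)=0$, $\Psi'>0$, $\Psi''\le0$ and $\Psi''$ non-increasing on $(0,\infty)$, and constants $l_0,r_1,c_0>0$ such that (b1) $\inf_{r\in(0,r_1]}\frac{\underline\alpha_{l_0}(r)}{r}>0$; (b2) $\Big[\sup_{r\in(0,r_1]}\frac{2\overline\beta(r)_+}{\Psi'(r+l_0)\underline\alpha_{l_0}(r)}+1\Big]\Psi(l_0)\le\log2$; (b3) $\overline\beta(r)\le-c_0r$ for all $r\in(r_1,\infty)$. Let $$c=\sup_{r\in(0,r_1]}\frac{2\overline\beta(r)_+}{\Psi'(r+l_0)\underline\alpha_{l_0}(r)}+1$$ and define $$f_3(r)=\int_0^re^{-c\Psi(s)}\,ds\quad\text{for }0\le r\le r_1+l_0,$$ $$f_3(r)=f_3(r_1+l_0)+\frac{f_3'(r_1+l_0)}2\int_{r_1+l_0}^r\Big[1+\exp\Big(\frac{2f_3''(r_1+l_0)}{f_3'(r_1+l_0)}(s-(r_1+l_0))\Big)\Big]ds\quad\text{for }r>r_1+l_0,$$ where $f_3'(r_1+l_0)=e^{-c\Psi(r_1+l_0)}$ and $f_3''(r_1+l_0)=-c\Psi'(r_1+l_0)e^{-c\Psi(r_1+l_0)}$. Let $\rho(x,y)=f_3(d(x,y))$. Then there exists a constant $c_*\in(0,1)$ such that for all $x,y\in S$, $$\mathbb E_{x,y}[\rho(X,Y)]\le(1-c_* )\rho(x,y).$$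
   Context: Let $(S,d)$ be a separable metric space and $p(x,dz)$ a Markov transition kernel on $S$. $((X,Y),\mathbb P_{x,y})$ is a Markov coupling of $p(x,\cdot)$ and $p(y,\cdot)$: there are random variables $X,Y:\Omega\to S$ on a common measurable space $(\Omega,\mathcal F)$ and probability measures $\mathbb P_{x,y}$ (depending on $(x,y)\in S\times S$ as a probability kernel) such that under $\mathbb P_{x,y}$, $X\sim p(x,\cdot)$ and $Y\sim p(y,\cdot)$. It is assumed that $\mathbb P_{x,x}(X=Y)=1$ for all $x\in S$. $\mathbb E_{x,y}$ is expectation under $\mathbb P_{x,y}$. For $x,y\in S$ and $l\ge0$ put $\beta(x,y)=\mathbb E_{x,y}[d(X,Y)-d(x,y)]$, $\alpha_l(x,y)=\frac12\mathbb E_{x,y}[(d(X,Y)-d(x,y))^2\mathbf 1_{\{d(X,Y)<d(x,y)+l\}}]$. For $r>0$ put $\overline\beta(r)=\sup_{d(x,y)=r}\beta(x,y)$, $\underline\alpha_l(r)=\inf_{d(x,y)=r}\alpha_l(x,y)$, and $\overline\beta(r)_+=\max(\overline\beta(r),0)$. Values $r$ that are not attained as a distance are ignored in infima and suprema over $r$ (a supremum of nonnegative quantities over an empty set is $0$). *)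

(* Defs.v *)
(* MathComp-Analysis *)
From HB Require Import structures.
From mathcomp Require Import all_boot all_order all_algebra.
From mathcomp Require Import all_classical all_reals all_analysis.

Set Implicit Arguments.
Unset Strict Implicit.
Unset Printing Implicit Defensive.

Import Order.TTheory GRing.Theory Num.Theory.
Import numFieldNormedType.Exports.

Local Open Scope classical_set_scope.
Local Open Scope ring_scope.

(* A base point is needed because [measurableType] inherits from
   [pointedType]; it only excludes the empty space. *)
#[short(type="pmetricType")]
HB.structure Definition PointedMetric (R : numDomainType) :=
  {M of Pointed M & Metric R M}.

Definition separable (T : topologicalType) : Prop :=
  exists2 D : set T, countable D & dense D.

Notation borel S := (g_sigma_algebraType (@open S)).

Section coupling.
Context {R : realType} {S : pmetricType R} {dO : measure_display}
  {Omega : measurableType dO}.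
Variables (p : R.-pker (borel S) ~> (borel S))
  (P : R.-pker (borel S * borel S) ~> Omega)
  (X Y : {mfun Omega >-> borel S}).

Definition is_markov_coupling : Prop :=
  (forall (x y : S) (A : set (borel S)), measurable A ->
     P (x, y) (X @^-1` A) = p x A) /\
  (forall (x y : S) (A : set (borel S)), measurable A ->
     P (x, y) (Y @^-1` A) = p y A).

(* The unfolding of 'E_(P (x, y))[Z]: the library does not register
   [P (x, y)] as a [probability]. Not assumed finite. *)
Definition coupling_expectation (x y : S) (Z : Omega -> R) : \bar R :=
  (\int[P (x, y)]_w (Z w)%:E)%E.

Definition coupled_dist (w : Omega) : R := mdist (X w : S) (Y w : S).

Definition beta (x y : S) : \bar R :=
  coupling_expectation x y (fun w => coupled_dist w - mdist x y).

Definition alpha (l : R) (x y : S) : \bar R :=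
  ((2^-1)%:E * coupling_expectation x y (fun w =>
     ((coupled_dist w - mdist x y) ^+ 2 *
      \1_[set w' | coupled_dist w' < mdist x y + l] w)%R))%E.

Definition beta_bar (r : R) : \bar R :=
  ereal_sup [set b | exists x y : S, mdist x y = r /\ b = beta x y].

Definition alpha_low (l r : R) : \bar R :=
  ereal_inf [set a | exists x y : S, mdist x y = r /\ a = alpha l x y].

End coupling.

Definition attained_dist {R : realType} (S : pmetricType R) : set R :=
  [set r | exists x y : S, mdist x y = r].

Definition small_dist {R : realType} (S : pmetricType R) (r1 : R) : set R :=
  attained_dist S `&` `]0, r1].

Section contraction_data.
Context {R : realType} {S : pmetricType R} {dO : measure_display}
  {Omega : measurableType dO}.
Variables (P : R.-pker (borel S * borel S) ~> Omega)
  (X Y : {mfun Omega >-> borel S}).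

Definition drift_ratio (Psi : R -> R) (l0 r : R) : \bar R :=
  ((2%:E * maxe (beta_bar P X Y r) 0) /
   ((derive1 Psi (r + l0))%:E * alpha_low P X Y l0 r))%E.

(* [maxe 0] only matters when [small_dist S r1] is empty: the supremum of
   nonnegative quantities over the empty set is 0 here, not -oo. *)
Definition c_const (Psi : R -> R) (l0 r1 : R) : \bar R :=
  (maxe 0 (ereal_sup [set drift_ratio Psi l0 r | r in small_dist S r1]) + 1)%E.

End contraction_data.

(* Only the values of [Psi] on [0, +oo[ are constrained. *)
Definition admissible_Psi {R : realType} (Psi : R -> R) : Prop :=
  [/\ {within `[0, +oo[, continuous Psi},
      (forall r : R, 0 < r ->
         [/\ derivable Psi r 1, derivable (derive1 Psi) r 1 &
             {for r, continuous (derive1n 2 Psi)}]),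
      (forall r : R, 0 <= r -> 0 <= Psi r) /\ Psi 0 = 0,
      (forall r : R, 0 < r -> 0 < derive1 Psi r /\ derive1n 2 Psi r <= 0) &
      (forall r s : R, 0 < r -> r <= s -> derive1n 2 Psi s <= derive1n 2 Psi r)].

Section f3.
Context {R : realType}.
Variables (Psi : R -> R) (l0 r1 c : R).

Let mu := @lebesgue_measure R.
Let a := r1 + l0.

Definition f3_inner (r : R) : R := \int[mu]_(s in `[0, r]) expR (- c * Psi s).

(* First and second derivatives of [f3_inner] at [a]. *)
Definition f3_d1 : R := expR (- c * Psi a).
Definition f3_d2 : R := - c * derive1 Psi a * expR (- c * Psi a).

Definition f3 (r : R) : R :=
  if r <= a then f3_inner r
  else f3_inner a + f3_d1 / 2 *
    \int[mu]_(s in `[a, r]) (1 + expR (2 * f3_d2 / f3_d1 * (s - a))).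

End f3.

(* Main.v *)
Require Import Defs.
From HB Require Import structures.
From mathcomp Require Import all_boot all_order all_algebra.
From mathcomp Require Import all_classical all_reals all_analysis.
From mathcomp Require Import measurable_realfun ring lra.

(** Write [f] for [f3] and [r = d(x, y)].  The function [f] is increasing,
    concave, below the identity, and its slope stays above half of
    [exp (- c * Psi (r1 + l0))].

    Far from the diagonal ([r > r1]) the tangent inequality
    [f R <= f r + f' r * (R - r)] applied to [R = d(X, Y)] gives
    [E f R - f r <= f' r * beta <= - c0 * f' r * r], a fixed negative fraction
    of [r], hence of [f r].

    Near the diagonal ([0 < r <= r1]) the drift [beta] may be positive and has
    to be beaten by the curvature of [f].  On ]0, r1 + l0] the second
    derivative [- c * Psi' * exp (- c * Psi)] is nondecreasing, so below
    [r + l0] it is at most its value at [r + l0]; a second-order Taylor bound,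
    used only on the event [R < r + l0], turns the truncated second moment
    into a gain ([coupling_expectation_le]):
      [E f R - f r <= f' r * beta
                      - c * Psi' (r + l0) * exp (- c * Psi (r + l0)) * alpha].
    Subadditivity of [Psi] and [c * Psi l0 <= ln 2] show that
    [exp (- c * Psi (r + l0))] is at least half of [f' r = exp (- c * Psi r)]
    ([f3_slope_shift]).  The constant [c] is chosen so that
    [beta <= (c - 1) / 2 * Psi' (r + l0) * alpha] ([beta_bar_le]); the summand 1
    in [c] therefore leaves the negative amount
    [- f' r * Psi' (r + l0) * alpha / 2], and [alpha] is at least a multiple of
    [r], hence of [f r], by [b1].

    On the diagonal both sides vanish because [X = Y] almost surely.

    Every expectation above has to be a genuine Lebesgue integral: separability
    makes [d(X, Y)] measurable, and since [d(X, Y) - r] is bounded below, an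
    upper bound on [beta] already makes it integrable. *)

Import Order.TTheory GRing.Theory Num.Theory.
Import numFieldNormedType.Exports.

Local Open Scope classical_set_scope.
Local Open Scope ring_scope.

(** * Second-order Taylor bound *)

(** The third hypothesis is the form that [f'' <= m] takes without a second
    derivative: [f - m / 2 * id ^ 2] has a nonincreasing derivative, so it is
    concave and lies below its tangent at [r].  Taking [m = 0] gives the
    tangent inequality of a concave function. *)
Lemma le_taylor2 (R : realType) (f g : R -> R) (m b r y : R) :
    {within `[0, b], continuous f} ->
    (forall s, 0 < s < b -> is_derive s 1 f (g s)) ->
    (forall s t, 0 < s -> s <= t -> t < b -> g t - m * t <= g s - m * s) ->
    0 < r < b -> 0 <= y <= b ->
  f y <= f r + g r * (y - r) + m / 2 * (y - r) ^+ 2.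
Proof.
move=> fcont fder ghom /andP[r0 rb] /andP[y0 yb].
pose F : R -> R := fun s => f s - m / 2 * s ^+ 2.
have Fder s : 0 < s < b -> is_derive s 1 F (g s - m * s).
  move=> sb; have fs := fder _ sb.
  rewrite /F; apply: is_derive_eq.
  change (g s - m / 2 * (s * 1 + s * 1) = g s - m * s :> R).
  by field.
have Fcont u v : 0 <= u -> v <= b -> {within `[u, v], continuous F}.
  move=> u0 vb.
  have -> : F = f - (fun s => m / 2 * s ^+ 2) by apply/funext.
  have fuv : {within `[u, v], continuous f}.
    apply: continuous_subspaceW fcont => z /=; rewrite !in_itv/= => /andP[uz zv].
    by rewrite (le_trans u0 uz) (le_trans zv vb).
  apply: within_continuousB; first exact: fuv.
  apply: continuous_subspaceT => z.
  by apply: cvgM; [exact: cvg_cst|exact: exprn_continuous].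
have [yr|ry|<-] := ltgtP r y.
- have [|| xi] := @MVT R F (fun s => g s - m * s) r y yr.
  + move=> s; rewrite in_itv/= => /andP[s1 s2]; apply: Fder.
    by rewrite (lt_trans r0 s1) (lt_le_trans s2 yb).
  + exact: Fcont (ltW r0) yb.
  rewrite in_itv/= => /andP[x1 x2] E.
  have := ghom r xi r0 (ltW x1) (lt_le_trans x2 yb).
  have yr0 : 0 <= y - r by rewrite subr_ge0 ltW.
  move/(ler_wpM2r yr0); rewrite -E /F; lra.
- have [|| xi] := @MVT R F (fun s => g s - m * s) y r ry.
  + move=> s; rewrite in_itv/= => /andP[s1 s2]; apply: Fder.
    by rewrite (le_lt_trans y0 s1) (lt_trans s2 rb).
  + exact: Fcont y0 (ltW rb).
  rewrite in_itv/= => /andP[x1 x2] E.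
  have := ghom xi r (le_lt_trans y0 x1) (ltW x2) rb.
  have yr0 : 0 <= r - y by rewrite subr_ge0 ltW.
  move/(ler_wpM2r yr0); rewrite -E /F; lra.
- by rewrite subrr expr0n/= !mulr0 !addr0.
Qed.

Lemma derivable_is_derive1 (R : realType) (f : R -> R) (x : R) :
  derivable f x 1 -> is_derive x 1 f (derive1 f x).
Proof. by move=> fx; rewrite derive1E; exact/derivableP. Qed.

(** * Consequences of admissibility of [Psi] *)

Section admissible.
Context {R : realType} {Psi : R -> R}.
Hypothesis Psi_adm : admissible_Psi Psi.

Lemma admissible_within (u v : R) : 0 <= u ->
  {within `[u, v], continuous Psi}.
Proof.
case: Psi_adm => Pc _ _ _ _ u0; apply: continuous_subspaceW Pc => z /=.
by rewrite !in_itv/= andbT => /andP[uz _]; exact: le_trans uz.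
Qed.

Lemma admissible_is_derive (s : R) : 0 < s -> is_derive s 1 Psi (derive1 Psi s).
Proof.
by case: Psi_adm => _ Pd _ _ _ /Pd[Ps _ _]; exact: derivable_is_derive1.
Qed.

Lemma admissible_derive1_gt0 (s : R) : 0 < s -> 0 < derive1 Psi s.
Proof. by case: Psi_adm => _ _ _ Pp _ s0; case: (Pp s s0). Qed.

Lemma admissible_derive1_nincr (s t : R) : 0 < s -> s <= t ->
  derive1 Psi t <= derive1 Psi s.
Proof.
case: Psi_adm => _ Pd _ Pp _ s0; rewrite le_eqVlt => /predU1P[->//|st].
have t0 u : u \in `[s, t] -> 0 < u.
  by rewrite in_itv/= => /andP[su _]; exact: lt_le_trans su.
have [||xi xist E] := @MVT R (derive1 Psi) (derive1 (derive1 Psi)) s t st.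
- move=> u ust; have u0 := t0 u (subset_itv_oo_cc ust).
  by have [_ Ps _] := Pd u u0; exact: derivable_is_derive1 Ps.
- apply: derivable_within_continuous => u ust.
  by have [] := Pd u (t0 u ust).
- have xi0 := t0 xi (subset_itv_oo_cc xist).
  rewrite -subr_le0 E pmulr_lle0 ?subr_gt0//.
  by case: (Pp xi xi0).
Qed.

Lemma admissible0 : Psi 0 = 0.
Proof. by case: Psi_adm => _ _ [_ ->]. Qed.

Lemma admissible_ndecr (s t : R) : 0 <= s -> s <= t -> Psi s <= Psi t.
Proof.
move=> s0; rewrite le_eqVlt => /predU1P[->//|st].
have [||xi] := @MVT R Psi (derive1 Psi) s t st.
- move=> u; rewrite in_itv/= => /andP[su _].
  exact: admissible_is_derive (le_lt_trans s0 su).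
- exact: admissible_within.
- rewrite in_itv/= => /andP[sxi _] E.
  rewrite -subr_ge0 E mulr_ge0 ?subr_ge0 ?ltW//.
  exact: admissible_derive1_gt0 (le_lt_trans s0 sxi).
Qed.

Lemma admissible_gt0 (s : R) : 0 < s -> 0 < Psi s.
Proof.
move=> s0; have [||xi] := @MVT R Psi (derive1 Psi) 0 s s0.
- move=> u; rewrite in_itv/= => /andP[su _].
  exact: admissible_is_derive.
- exact: admissible_within.
- rewrite in_itv/= admissible0 !subr0 => /andP[sxi _] ->.
  by rewrite mulr_gt0// admissible_derive1_gt0.
Qed.

(** [u |-> Psi (u + s) - Psi u] is nonincreasing because [Psi'] is, and its
    value at 0 is [Psi s]. *)
Lemma admissible_subadditive (s t : R) : 0 < s -> 0 < t ->
  Psi (s + t) <= Psi s + Psi t.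
Proof.
move=> s0 t0; pose h := (Psi \o shift s) - Psi.
have [||xi] := @MVT R h (fun u => derive1 Psi (u + s) - derive1 Psi u) 0 t t0.
- move=> u; rewrite in_itv/= => /andP[u0 _].
  have su0 : 0 < u + s by rewrite addr_gt0.
  have dPu := admissible_is_derive _ u0.
  have dPs := admissible_is_derive _ su0.
  have dPss : is_derive u 1 (Psi \o shift s) (derive1 Psi (u + s)).
    rewrite -[derive1 Psi _]mulr1.
    exact: (@is_derive1_comp R Psi (shift s) u _ _ dPs (is_derive_shift _ _ _)).
  exact: is_deriveB.
- have Psis : {within `[0, t], continuous (Psi \o shift s)}.
    apply: derivable_within_continuous => u; rewrite in_itv/= => /andP[u0 _].
    have su0 : 0 < u + s by rewrite ltr_wpDl.
    have dPs := admissible_is_derive _ su0.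
    by have [] := @is_derive1_comp R Psi (shift s) u _ _ dPs (is_derive_shift _ _ _).
  apply: within_continuousB; first exact: Psis.
  exact: admissible_within.
- rewrite in_itv/= => /andP[xi0 xit].
  rewrite /h !fctE/= add0r admissible0 !subr0 => E.
  have : (derive1 Psi (xi + s) - derive1 Psi xi) * t <= 0.
    rewrite pmulr_lle0// subr_le0 admissible_derive1_nincr//.
    by rewrite lerDl ltW.
  rewrite -E (addrC s t); lra.
Qed.

End admissible.

(** * The function [f3] *)

Section f3_theory.
Context {R : realType} {Psi : R -> R}.
Hypothesis Psi_adm : admissible_Psi Psi.
Context {l0 r1 c : R}.
Hypotheses (l0_gt0 : 0 < l0) (r1_gt0 : 0 < r1) (c_ge0 : 0 <= c).
Notation mu := (@lebesgue_measure R).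
Notation a := (r1 + l0).

(** The derivative of [f3], on both sides of [r1 + l0] at once: for [s] below
    [r1 + l0] the second factor is 1, and for [s] above it the first factor is
    frozen at [f3_d1].  Written as a product of two nonnegative nonincreasing
    continuous functions, it needs no gluing argument at [r1 + l0].  The maximum
    with 0 is there because [Psi] is unconstrained on negative numbers. *)
Definition f3_slope (s : R) : R :=
  expR (- c * Psi (Num.min (Num.max s 0) a)) *
  ((1 + expR (2 * f3_d2 Psi l0 r1 c / f3_d1 Psi l0 r1 c * (Num.max s a - a))) / 2).

Let a_gt0 : 0 < a. Proof. exact: addr_gt0. Qed.

Lemma f3_d1_gt0 : 0 < f3_d1 Psi l0 r1 c. Proof. exact: expR_gt0. Qed.

Lemma f3_curvature_le0 : 2 * f3_d2 Psi l0 r1 c / f3_d1 Psi l0 r1 c <= 0.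
Proof.
rewrite pmulr_lle0 ?invr_gt0 ?f3_d1_gt0// pmulr_rle0// /f3_d2.
rewrite pmulr_lle0 ?expR_gt0// mulNr oppr_le0 mulr_ge0//.
by rewrite ltW// admissible_derive1_gt0.
Qed.

Lemma f3_slopeE (s : R) : 0 <= s <= a -> f3_slope s = expR (- c * Psi s).
Proof.
move=> /andP[s0 sa]; rewrite /f3_slope (max_idPl s0) (min_idPl sa).
by rewrite (max_idPr sa) subrr mulr0 expR0 divff ?mulr1.
Qed.

Lemma f3_slope_tail (s : R) : a <= s ->
  f3_slope s = f3_d1 Psi l0 r1 c / 2 *
    (1 + expR (2 * f3_d2 Psi l0 r1 c / f3_d1 Psi l0 r1 c * (s - a))).
Proof.
move=> sa; have s0 : 0 <= s := le_trans (ltW a_gt0) sa.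
rewrite /f3_slope (max_idPl s0) (min_idPr sa) (max_idPl sa).
by rewrite -/(f3_d1 Psi l0 r1 c) mulrA mulrAC.
Qed.

Lemma f3_slope_nincr (s t : R) : s <= t -> f3_slope t <= f3_slope s.
Proof.
move=> st; apply: ler_pM; first exact: expR_ge0.
- by rewrite divr_ge0// addr_ge0// expR_ge0.
- rewrite ler_expR !mulNr lerN2 ler_wpM2l// admissible_ndecr//.
    by rewrite le_min le_max lexx orbT ltW.
  by rewrite le_min2// le_max2.
- rewrite ler_pM2r// lerD2l ler_expR ler_wnM2l ?f3_curvature_le0// lerD2r.
  by rewrite le_max2.
Qed.

Lemma f3_slope_le1 (s : R) : f3_slope s <= 1.
Proof.
have c0 : c * Psi 0 = 0 by rewrite (admissible0 Psi_adm) mulr0.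
rewrite (@le_trans _ _ (f3_slope (Num.min s 0)))//.
  by rewrite f3_slope_nincr// ge_min lexx.
have s0 : Num.min s 0 <= 0 by rewrite ge_min lexx orbT.
rewrite /f3_slope (max_idPr s0) (min_idPl (ltW a_gt0)) mulNr c0 oppr0 expR0.
rewrite (max_idPr (le_trans s0 (ltW a_gt0))) subrr mulr0 expR0.
by rewrite divff// mulr1.
Qed.

Lemma f3_slope_ge (s : R) : f3_d1 Psi l0 r1 c / 2 <= f3_slope s.
Proof.
rewrite (@le_trans _ _ (f3_slope (Num.max s a)))//; last first.
  by rewrite f3_slope_nincr// le_max lexx.
rewrite f3_slope_tail ?le_max ?lexx ?orbT//.
by rewrite ler_peMr ?divr_ge0 ?expR_ge0// lerDl expR_ge0.
Qed.

Lemma f3_slope_gt0 (s : R) : 0 < f3_slope s.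
Proof. by rewrite (lt_le_trans _ (f3_slope_ge s))// divr_gt0 ?f3_d1_gt0. Qed.

Lemma f3_slope_continuous : continuous f3_slope.
Proof.
have Psic : continuous (fun s : R => Psi (Num.min (Num.max s 0) a)).
  have [Pc _ _ _ _] := Psi_adm => s.
  (* [Psi] is only continuous within [0, +oo[, where [h] takes its values. *)
  pose h (s : R) := Num.min (Num.max s 0) a.
  have hc : h x @[x --> s] --> (h s : R).
    apply: (@continuous_min R R (fun x : R => Num.max x 0) (cst a)).
      apply: (@continuous_max R R id (cst 0)); first exact: cvg_id.
      exact: cvg_cst.
    exact: cvg_cst.
  have h0 x : (`[0, +oo[%classic : set R) (h x).
    by rewrite /= in_itv/= andbT le_min le_max lexx orbT ltW.
  apply: (@cvg_comp _ _ _ h Psi _ (within (`[0, +oo[%classic : set R) (nbhs (h s)))).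
    move=> A /hc hA.
    have {}hA : \forall x \near s, `[0, +oo[%classic (h x) -> A (h x) := hA.
    by apply: filterS hA => x; apply; exact: h0.
  by rewrite nbhs_subspace_in//; exact: Pc.
move=> s; apply: cvgM.
  apply: (@continuous_comp _ _ _ (fun s : R => - c * Psi (Num.min (Num.max s 0) a)) expR).
    by apply: cvgM; [exact: cvg_cst|exact: Psic].
  exact: continuous_expR.
apply: cvgM; last exact: cvg_cst.
apply: cvgD; first exact: cvg_cst.
apply: (@continuous_comp _ _ _ (fun s : R => _ * (Num.max s a - a)) expR);
  last exact: continuous_expR.
apply: cvgM; first exact: cvg_cst.
apply: cvgB; last exact: cvg_cst.
by apply: (@continuous_max R R id (cst a)); [exact: cvg_id|exact: cvg_cst].
Qed.

Lemma f3_slope_integrable (u v : R) : mu.-integrable `[u, v] (EFin \o f3_slope).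
Proof.
apply: continuous_compact_integrable; first exact: segment_compact.
exact/continuous_subspaceT/f3_slope_continuous.
Qed.

(** A single primitive for both branches of [f3], valid also for negative [r],
    where both integrals are over the empty set. *)
Lemma f3E : f3 Psi l0 r1 c = fun r => \int[mu]_(s in `[0, r]) f3_slope s.
Proof.
apply/funext => r; rewrite /f3.
have E u : u <= a -> f3_inner Psi c u = \int[mu]_(s in `[0, u]) f3_slope s.
  move=> ua; apply: eq_Rintegral => s; rewrite inE/= in_itv/= => /andP[s0 su].
  by rewrite f3_slopeE// s0 (le_trans su ua).
case: ifPn => [/E//|]; rewrite -ltNge => ar.
have intr : mu.-integrable `[0, r] (EFin \o f3_slope) by exact: f3_slope_integrable.
rewrite E// -[RHS](addrNK (\int[mu]_(s in `[0, a]) f3_slope s)) addrC.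
rewrite (Rintegral_itvB intr) ?bnd_simp ?ltW//; congr (_ + _).
have d1_neq0 : f3_d1 Psi l0 r1 c / 2 != 0 by rewrite gt_eqF// divr_gt0// f3_d1_gt0.
rewrite Rintegral_itv_obnd_cbnd; last first.
  by apply: integrableS (f3_slope_integrable a r) => //; exact: subset_itv_oc_cc.
rewrite (@eq_Rintegral _ _ _ mu _ (fun s => (f3_d1 Psi l0 r1 c / 2)^-1 * f3_slope s)).
  by rewrite RintegralZl ?mulVKf//; exact: f3_slope_integrable.
move=> s; rewrite inE/= in_itv/= => /andP[sa _].
by rewrite f3_slope_tail// mulKf.
Qed.

Lemma is_derive_f3 (s : R) : 0 < s -> is_derive s 1 (f3 Psi l0 r1 c) (f3_slope s).
Proof.
move=> s0; have ss1 : s < s + 1 by rewrite ltrDl.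
have [] := @continuous_FTC1_closed R f3_slope 0 s (s + 1) ss1
  (f3_slope_integrable _ _) s0 (f3_slope_continuous s).
by rewrite -f3E => /derivable_is_derive1 + <-.
Qed.

Lemma f3_within_continuous (b : R) : 0 <= b ->
  {within `[0, b], continuous (f3 Psi l0 r1 c)}.
Proof.
move=> b0; rewrite f3E.
exact: parameterized_integral_continuous (f3_slope_integrable _ _).
Qed.

Lemma f30 : f3 Psi l0 r1 c 0 = 0.
Proof. by rewrite f3E set_itv1 Rintegral_set1. Qed.

Lemma f3_ge0 (r : R) : 0 <= f3 Psi l0 r1 c r.
Proof. by rewrite f3E; apply: Rintegral_ge0 => s _; rewrite ltW// f3_slope_gt0. Qed.

Lemma f3_ndecr : nondecreasing_fun (f3 Psi l0 r1 c).
Proof.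
move=> u v uv; have [u0|u0] := ltP u 0.
  by rewrite {1}f3E set_itv_ge -?ltNge ?bnd_simp// Rintegral_set0 f3_ge0.
rewrite f3E -subr_ge0 (Rintegral_itvB (f3_slope_integrable _ _))//.
by apply: Rintegral_ge0 => s _; rewrite ltW// f3_slope_gt0.
Qed.

Lemma f3_le_id (r : R) : 0 <= r -> f3 Psi l0 r1 c r <= r.
Proof.
rewrite le_eqVlt => /predU1P[<-|r0]; first by rewrite f30.
have [||xi _] := @MVT R (f3 Psi l0 r1 c) f3_slope 0 r r0.
- by move=> s; rewrite in_itv/= => /andP[s0 _]; exact: is_derive_f3.
- exact: f3_within_continuous _ (ltW r0).
- by rewrite f30 !subr0 => ->; rewrite ler_piMl// ?f3_slope_le1 ?ltW.
Qed.

Lemma f3_le_tangent (r y : R) : 0 < r -> 0 <= y ->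
  f3 Psi l0 r1 c y <= f3 Psi l0 r1 c r + f3_slope r * (y - r).
Proof.
move=> r0 y0; pose b := Num.max r y + 1.
have rb : r < b by rewrite ltr_pwDr// le_max lexx.
have yb : y < b by rewrite ltr_pwDr// le_max lexx orbT.
have b0 : 0 <= b := ltW (lt_trans r0 rb).
have := @le_taylor2 R (f3 Psi l0 r1 c) f3_slope 0 b r y (f3_within_continuous _ b0).
rewrite !mul0r addr0; apply.
- by move=> s /andP[s0 _]; exact: is_derive_f3.
- by move=> s t s0 st _; rewrite !mul0r !subr0 f3_slope_nincr.
- by rewrite r0 rb.
- by rewrite y0 ltW.
Qed.

Lemma f3_slope_head_derive (s : R) : 0 < s ->
  is_derive s 1 (fun u => expR (- c * Psi u))
    (- c * derive1 Psi s * expR (- c * Psi s)).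
Proof.
move=> s0; have dPsi := admissible_is_derive Psi_adm _ s0.
have dcPsi : is_derive s 1 (fun u => - c * Psi u) (- c * derive1 Psi s).
  exact: is_deriveZ.
rewrite mulrC; exact: (@is_derive1_comp R expR (fun u => - c * Psi u) s).
Qed.

(** The coefficient of the square is half of [f3'' (r + l0)], an upper bound of
    [f3''] on the whole of ]0, r + l0]: there [f3'' = - c * Psi' * exp (- c * Psi)]
    is nondecreasing, as [Psi'] and [exp (- c * Psi)] are both nonincreasing. *)
Lemma f3_le_taylor2 (r y : R) : 0 < r <= r1 -> 0 <= y <= r + l0 ->
  f3 Psi l0 r1 c y <= f3 Psi l0 r1 c r + f3_slope r * (y - r) +
    (- c * derive1 Psi (r + l0) * expR (- c * Psi (r + l0))) / 2 * (y - r) ^+ 2.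
Proof.
move=> /andP[r0 rr1] yl; have rl0 : 0 < r + l0 by rewrite addr_gt0.
apply: (@le_taylor2 R _ _ _ (r + l0)) => //.
- exact: f3_within_continuous _ (ltW rl0).
- by move=> s /andP[s0 _]; exact: is_derive_f3.
- move=> s t s0; rewrite le_eqVlt => /predU1P[->//|st] trl.
  have ta : t <= a by rewrite (le_trans (ltW trl))// lerD2r.
  have t0 : 0 < t := lt_trans s0 st.
  rewrite !f3_slopeE ?(ltW t0) ?(ltW s0) ?ta ?(le_trans (ltW st) ta)//.
  have [||xi] := @MVT R (fun u => expR (- c * Psi u))
    (fun u => - c * derive1 Psi u * expR (- c * Psi u)) s t st.
  + move=> u; rewrite in_itv/= => /andP[su _].
    exact: f3_slope_head_derive _ (lt_trans s0 su).
  + apply: derivable_within_continuous => u; rewrite in_itv/= => /andP[su _].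
    by have [] := f3_slope_head_derive _ (lt_le_trans s0 su).
  + rewrite in_itv/= => /andP[sxi xit] E.
    have xi0 := lt_trans s0 sxi.
    have xirl := ltW (lt_trans xit trl).
    (* [E] is the mean value theorem for the slope, with [f3'' xi <= m]. *)
    pose m := - c * derive1 Psi (r + l0) * expR (- c * Psi (r + l0)).
    suff : - c * derive1 Psi xi * expR (- c * Psi xi) * (t - s) <= m * (t - s).
      rewrite -E mulrBr -/m; lra.
    rewrite ler_wpM2r ?subr_ge0 ?(ltW st)// /m !mulNr. rewrite lerN2.
    apply: ler_pM; rewrite ?expR_ge0//.
    * by rewrite mulr_ge0// ltW// admissible_derive1_gt0.
    * by rewrite ler_wpM2l// admissible_derive1_nincr.
    * by rewrite ler_expR lerN2 ler_wpM2l// admissible_ndecr// ltW.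
- by rewrite r0 ltrDl.
Qed.

(** Moving from [r] to [r + l0] costs at most a factor [exp (c * Psi l0) <= 2]
    by subadditivity of [Psi]. *)
Lemma f3_slope_shift (r : R) : 0 < r <= r1 -> c * Psi l0 <= ln 2 ->
  f3_slope r / 2 <= expR (- c * Psi (r + l0)).
Proof.
move=> /andP[r0 rr1] cPsi; rewrite f3_slopeE; last first.
  by rewrite ltW//= (le_trans rr1)// lerDl ltW.
rewrite -[X in _ / X]lnK ?posrE// -expRN -expRD ler_expR !mulNr -opprD lerN2.
rewrite (le_trans (ler_wpM2l c_ge0 (admissible_subadditive Psi_adm _ _ r0 l0_gt0)))//.
by rewrite mulrDr lerD2l.
Qed.

End f3_theory.

(** * Measurability of the coupled distance *)

Section measurable_distance.
Context {R : realType} {S : pmetricType R} {d : measure_display}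
  {T : measurableType d}.

Lemma open_mdist_lt (q : S) (r : R) : open [set x : S | mdist x q < r].
Proof.
rewrite openE => x /= xq; apply/nbhs_ballP.
exists (r - mdist x q); first by rewrite /= subr_gt0.
move=> y; rewrite ballEmdist/= => xy.
have := metric_triangle y x q; rewrite (metric_sym y x); lra.
Qed.

Lemma measurable_mdist_lt (q : S) (r : R) :
  measurable ([set x | mdist x q < r] : set (borel S)).
Proof. by apply: sub_sigma_algebra; exact: open_mdist_lt. Qed.

Lemma measurable_mdist_cst (q : S) (X : {mfun T >-> borel S}) :
  measurable_fun setT (fun w => mdist (X w : S) q).
Proof.
apply: (measurability (@RGenInftyO.G R)) => [|/= _ [_] [r] -> <-].
  exact: RGenInftyO.measurableE.
rewrite setTI.
have := @measurable_funPT _ _ _ _ X measurableT _ (measurable_mdist_lt q r).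
by rewrite setTI.
Qed.

(** Through points of a dense set, [d(x, y) < r] becomes a condition on the
    distances of [x] and [y] to fixed points, which are Borel functions of [x]
    and of [y] separately.  With a countable dense set this exhibits
    [d(x, y) < r] as an event of the product of the Borel sigma-algebras, which
    for a nonseparable space need not contain the open sets of the product. *)
Lemma mdist_ltP (D : set S) (x y : S) (r : R) : dense D ->
  mdist x y < r <-> exists2 q, D q & mdist x q + mdist y q < r.
Proof.
move=> Dd; split=> [xyr|[q _]]; last first.
  by apply: le_lt_trans; rewrite (metric_sym y q) metric_triangle.
have e0 : 0 < (r - mdist x y) / 2 by rewrite divr_gt0 ?subr_gt0.
have [|q [/= xq Dq]] := Dd _ _ (open_mdist_lt x ((r - mdist x y) / 2)).
  by exists x; rewrite /= mdistxx.
exists q => //; rewrite (metric_sym x q).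
have := metric_triangle y x q; rewrite (metric_sym y x) (metric_sym x q); lra.
Qed.

Lemma measurable_coupled_dist (X Y : {mfun T >-> borel S}) :
  separable S -> measurable_fun setT (coupled_dist X Y).
Proof.
move=> [D Dc Dd].
apply: (measurability (@RGenInftyO.G R)) => [|/= _ [_] [r] -> <-].
  exact: RGenInftyO.measurableE.
rewrite setTI.
have -> : coupled_dist X Y @^-1` `]-oo, r[ =
    \bigcup_(q in D) [set w | mdist (X w : S) q + mdist (Y w : S) q < r].
  apply/seteqP; split=> w /=; rewrite in_itv/= /coupled_dist.
    by move=> /(mdist_ltP _ _ _ _ Dd)[q Dq ?]; exists q.
  by move=> [q Dq ?]; apply/(mdist_ltP _ _ _ _ Dd); exists q.
rewrite bigcup_set_type; apply: countable_bigcupT_measurable => [|q].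
  by rewrite (eq_countable (card_setT _)).
have mXY : measurable_fun setT
    (fun w => mdist (X w : S) (val q) + mdist (Y w : S) (val q)).
  by apply: measurable_funD; exact: measurable_mdist_cst.
have := mXY measurableT _ (measurable_itv `]-oo, r[); rewrite setTI.
by congr measurable; apply/seteqP; split=> w /=; rewrite in_itv.
Qed.

End measurable_distance.

(** * Integrals against a measure of total mass 1 *)

Section integrals.
Context {R : realType} {d : measure_display} {T : measurableType d}.
Variable mu : {measure set T -> \bar R}.
Hypothesis mu1 : mu setT = 1%E.

(** The lower bound makes the integral of the negative part finite, so the
    integral is not of the form [+oo - oo] and can only fail to be finite by
    being [+oo]. *)
Lemma integrable_of_lower_bound (U : T -> R) (r : R) :
    measurable_fun setT U -> (forall w, - r <= U w) ->
    (\int[mu]_w (U w)%:E < +oo)%E ->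
  mu.-integrable setT (EFin \o U).
Proof.
move=> mU Ur Uy; have mEU : measurable_fun setT (EFin \o U) by exact/measurable_EFinP.
have neg_lty : (\int[mu]_w (EFin \o U)^\- w < +oo)%E.
  apply: (@le_lt_trans _ _ (\int[mu]_(w in setT) (cst `|r|%:E) w)%E).
    apply: ge0_le_integral => //.
    - exact: measurable_funeneg.
    - move=> w _; rewrite funenegE/= -EFin_max lee_fin ge_max normr_ge0 andbT.
      by rewrite lerNl (le_trans _ (Ur w))// lerN2 ler_norm.
  by rewrite integral_cst// mu1 mule1 ltry.
have neg_ge0 : (0 <= \int[mu]_w (EFin \o U)^\- w)%E by exact: integral_ge0.
have pos_lty : (\int[mu]_w (EFin \o U)^\+ w < +oo)%E.
  move: Uy; rewrite integralE.
  have : (\int[mu]_w (EFin \o U)^\- w)%E \is a fin_num by rewrite ge0_fin_numE.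
  move: neg_ge0; case: (\int[mu]_w (EFin \o U)^\- w)%E => // n _ _.
  by case: (\int[mu]_w (EFin \o U)^\+ w)%E => // p _; rewrite ltry.
apply/integrableP; split=> //.
rewrite [X in (X < _)%E](_ : _ =
  (\int[mu]_w ((EFin \o U)^\+ w + (EFin \o U)^\- w))%E); last first.
  by apply: eq_integral => w _; rewrite -/((abse \o (EFin \o U)) w) fune_abse.
rewrite ge0_integralD//; [|exact: measurable_funepos|exact: measurable_funeneg].
exact: lte_add_pinfty.
Qed.

(** Linearity and monotonicity in the form used for drift estimates: [U] is the
    increment of the distance and [V] its truncated square. *)
Lemma integral_le_affine (H U V : T -> R) (A B m : R) :
    measurable_fun setT H -> (forall w, 0 <= H w) ->
    mu.-integrable setT (EFin \o U) -> mu.-integrable setT (EFin \o V) ->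
    (forall w, H w <= A + B * U w + m * V w) ->
  (\int[mu]_w (H w)%:E <=
    (A + B * fine (\int[mu]_w (U w)%:E) + m * fine (\int[mu]_w (V w)%:E))%:E)%E.
Proof.
move=> mH H0 iU iV HUV.
have iBU : mu.-integrable setT (EFin \o (fun w => B * U w)).
  exact: (@integrableZl _ _ _ mu _ measurableT B _ iU).
have imV : mu.-integrable setT (EFin \o (fun w => m * V w)).
  exact: (@integrableZl _ _ _ mu _ measurableT m _ iV).
have iA : mu.-integrable setT (EFin \o (fun=> A)).
  apply: measurable_bounded_integrable => //; first by rewrite mu1 ltry.
  exact: bounded_cst.
have iABU : mu.-integrable setT (EFin \o (fun w => A + B * U w)).
  by have := integrableD measurableT iA iBU; apply: eq_integrable.
have iABUV : mu.-integrable setT (EFin \o (fun w => A + B * U w + m * V w)).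
  by have := integrableD measurableT iABU imV; apply: eq_integrable.
apply: (@le_trans _ _ (\int[mu]_w (A + B * U w + m * V w)%:E)%E).
  apply: ge0_le_integral => //.
  - by move=> w _; rewrite lee_fin.
  - exact/measurable_EFinP.
  - exact: (measurable_int _ iABUV).
  - by move=> w _; rewrite lee_fin.
have fU := integrable_fin_num measurableT iU.
have fV := integrable_fin_num measurableT iV.
have -> : (\int[mu]_w (A + B * U w + m * V w)%:E =
    A%:E + B%:E * \int[mu]_w (U w)%:E + m%:E * \int[mu]_w (V w)%:E)%E.
  rewrite (integralD_EFin measurableT iABU imV) (integralD_EFin measurableT iA iBU).
  rewrite (@integralZl _ _ _ mu setT measurableT _ iU).
  rewrite (@integralZl _ _ _ mu setT measurableT _ iV).
  by rewrite integral_cst// mu1 mule1.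
by rewrite 2!EFinD 2!EFinM !fineK.
Qed.

(** On the event [Z < r + l] the nonnegative [Z] stays within [r + |l|] of [r]. *)
Lemma integrable_truncated_sq (Z : T -> R) (r l : R) :
    0 <= r -> measurable_fun setT Z -> (forall w, 0 <= Z w) ->
  mu.-integrable setT
    (EFin \o (fun w => (Z w - r) ^+ 2 * \1_[set w' | Z w' < r + l] w)).
Proof.
move=> r0 mZ Z0.
have mA : measurable [set w | Z w < r + l].
  have := mZ measurableT _ (measurable_itv `]-oo, (r + l)[).
  by rewrite setTI; congr measurable; apply/seteqP; split=> w /=; rewrite in_itv.
apply: measurable_bounded_integrable => //; first by rewrite mu1 ltry.
- apply: measurable_funM; last exact: measurable_indic.
  by apply: measurable_funX; apply: measurable_funB.
- exists ((r + `|l|) ^+ 2); split; first by rewrite num_real.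
  move=> M rM w _ /=; rewrite (le_trans _ (ltW rM))//.
  rewrite indicE normrM normrX; case: (boolP (w \in _)) => [|_]; last first.
    by rewrite normr0 mulr0 sqr_ge0.
  rewrite inE/= normr1 mulr1 => Zl.
  rewrite ler_pXn2r ?nnegrE ?addr_ge0// ler_norml.
  have := ler_norm l; have := normr_ge0 l; have := Z0 w; lra.
Qed.

Lemma integral_eq0_almost_surely (H : T -> R) (E : set T) :
    measurable_fun setT H -> measurable E -> mu E = 1%E ->
    (forall w, E w -> H w = 0) ->
  (\int[mu]_w (H w)%:E = 0)%E.
Proof.
move=> mH mE muE EH; rewrite (ae_eq_integral (cst 0%E))//.
- exact: integral0.
- exact/measurable_EFinP.
- exists (setT `\` E); split.
  + exact: measurableD.
  + have mu_lty : (mu setT < +oo)%E by rewrite mu1 ltry.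
    have muD : mu (setT `\` E) = (mu setT - mu (setT `&` E))%E by exact: measureD.
    by rewrite muD mu1 setTI muE subee.
  + by move=> w /= nE; split=> // Ew; apply: nE => _; rewrite EH.
Qed.

End integrals.

(** * Drift estimates for a coupling *)

Section coupling_theory.
Context {R : realType} {S : pmetricType R} {dO : measure_display}
  {Omega : measurableType dO} {P : R.-pker (borel S * borel S) ~> Omega}
  {X Y : {mfun Omega >-> borel S}}.
Hypothesis S_separable : separable S.

Lemma coupled_dist_ge0 (w : Omega) : 0 <= coupled_dist X Y w.
Proof. exact: mdist_ge0. Qed.

Lemma coupling_integrable_dist (x y : S) : (beta P X Y x y < +oo)%E ->
  (P (x, y)).-integrable setT (EFin \o (fun w => coupled_dist X Y w - mdist x y)).
Proof.
move=> b_lty; apply: (@integrable_of_lower_bound _ _ _ _ _ _ (mdist x y)) => //.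
- exact: prob_kernel.
- by apply: measurable_funB => //; exact: measurable_coupled_dist.
- by move=> w; rewrite lerBrDr addNr coupled_dist_ge0.
Qed.

Lemma coupling_integrable_truncated (l : R) (x y : S) :
  (P (x, y)).-integrable setT (EFin \o (fun w =>
    (coupled_dist X Y w - mdist x y) ^+ 2 *
      \1_[set w' | coupled_dist X Y w' < mdist x y + l] w)).
Proof.
apply: integrable_truncated_sq => //.
- exact: prob_kernel.
- exact: mdist_ge0.
- exact: measurable_coupled_dist.
- exact: coupled_dist_ge0.
Qed.

Lemma alpha_fin_num (l : R) (x y : S) : alpha P X Y l x y \is a fin_num.
Proof.
apply: fin_numM => //; apply: integrable_fin_num => //.
exact: coupling_integrable_truncated.
Qed.

(** The factor [m / 2] in the hypothesis matches the factor one half in the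
    definition of [alpha], which leaves [m] in the conclusion. *)
Lemma coupling_expectation_le (F : R -> R) (B m l : R) (x y : S) :
    nondecreasing_fun F -> (forall z, 0 <= F z) -> (beta P X Y x y < +oo)%E ->
    (forall z, 0 <= z -> F z <= F (mdist x y) + B * (z - mdist x y) +
       m / 2 * ((z - mdist x y) ^+ 2 * \1_[set z' | z' < mdist x y + l] z)) ->
  (coupling_expectation P x y (fun w => F (mdist (X w : S) (Y w : S))) <=
    (F (mdist x y) + B * fine (beta P X Y x y) + m * fine (alpha P X Y l x y))%:E)%E.
Proof.
move=> F_nd F0 b_lty FZ.
have -> : m * fine (alpha P X Y l x y) = m / 2 * fine
  (\int[P (x, y)]_w ((coupled_dist X Y w - mdist x y) ^+ 2 *
      \1_[set w' | coupled_dist X Y w' < mdist x y + l] w)%:E)%E.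
  rewrite /alpha fineM//; first by rewrite mulrA.
  by apply: integrable_fin_num => //; exact: coupling_integrable_truncated.
apply: integral_le_affine => //.
- exact: prob_kernel.
- apply: (measurableT_comp (nondecreasing_measurable _ F_nd)) => //.
  exact: measurable_coupled_dist.
- exact: coupling_integrable_dist.
- exact: coupling_integrable_truncated.
- by move=> w; exact: FZ (coupled_dist_ge0 w).
Qed.

(** The infimum is [+oo] when no distance in ]0, r1] is attained, hence
    the real number [kappa] below it in place of the infimum itself. *)
Lemma alpha_low_ge_linear (l0 r1 : R) :
    (0 < ereal_inf [set alpha_low P X Y l0 r / r%:E | r in small_dist S r1])%E ->
  exists2 kappa : R, 0 < kappa & forall x y : S, 0 < mdist x y <= r1 ->
    alpha_low P X Y l0 (mdist x y) \is a fin_num /\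
    kappa * mdist x y <= fine (alpha_low P X Y l0 (mdist x y)).
Proof.
set I := ereal_inf _ => I0.
have [kappa k0 kI] : exists2 kappa : R, 0 < kappa & (kappa%:E <= I)%E.
  move: I0; case: I => [i||]// i0; first by exists i; rewrite -?lte_fin.
  by exists 1; rewrite ?leey.
exists kappa => // x y /andP[r0 rr1].
have : (kappa%:E <= alpha_low P X Y l0 (mdist x y) / (mdist x y)%:E)%E.
  apply: (le_trans kI); apply: ereal_inf_lbound; exists (mdist x y) => //.
  split; first by exists x, y.
  by rewrite /= in_itv/= r0.
rewrite inver gt_eqF//.
have : (alpha_low P X Y l0 (mdist x y) <= alpha P X Y l0 x y)%E.
  by apply: ereal_inf_lbound; exists x, y.
have := alpha_fin_num l0 x y; case: (alpha P X Y l0 x y) => // al _.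
case: (alpha_low _ _ _ _ _) => [a||]//.
  by move=> _; rewrite -EFinM lee_fin ler_pdivlMr.
by move=> _; rewrite gt0_mulNye// lte_fin invr_gt0.
Qed.

(** If [c_const] were infinite then so would be its product with the positive
    number [Psi l0]. *)
Lemma c_const_fin_num (Psi : R -> R) (l0 r1 b : R) : 0 < Psi l0 ->
    (c_const P X Y Psi l0 r1 * (Psi l0)%:E <= b%:E)%E ->
  c_const P X Y Psi l0 r1 \is a fin_num /\ 1 <= fine (c_const P X Y Psi l0 r1).
Proof.
rewrite /c_const; set M := (maxe 0 _)%E => Psi0.
have : (0 <= M)%E by rewrite le_max lexx.
case: M => [m||]//=.
  by rewrite lee_fin => m0 _; split=> //; rewrite lerDr.
by move=> _; rewrite gt0_mulye.
Qed.

(** The summand 1 of [c_const] is split off: what remains bounds the drift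
    ratio at every attained [r] in ]0, r1]. *)
Lemma beta_bar_le (Psi : R -> R) (l0 r1 r : R) :
    small_dist S r1 r -> 0 < derive1 Psi (r + l0) ->
    alpha_low P X Y l0 r \is a fin_num -> 0 < fine (alpha_low P X Y l0 r) ->
    c_const P X Y Psi l0 r1 \is a fin_num ->
  (beta_bar P X Y r <= ((fine (c_const P X Y Psi l0 r1) - 1) / 2 *
     (derive1 Psi (r + l0) * fine (alpha_low P X Y l0 r)))%:E)%E.
Proof.
move=> rr1 dPsi afin a0 cfin.
have : (drift_ratio P X Y Psi l0 r <= c_const P X Y Psi l0 r1 - 1)%E.
  rewrite /c_const addeK// le_max; apply/orP; right.
  by apply: ereal_sup_ubound; exists r.
rewrite -(fineK cfin) /drift_ratio.
move: afin a0; case: (alpha_low _ _ _ _ _) => //= a _ a0.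
have da : 0 < derive1 Psi (r + l0) * a by rewrite mulr_gt0.
rewrite -EFinM inver gt_eqF//.
case: (beta_bar P X Y r) => [b||]//=; last by rewrite leNye.
- rewrite -EFin_max -!EFinM -EFinB !lee_fin ler_pdivrMr// => h.
  have bm : b <= Num.max b 0 by rewrite le_max lexx.
  rewrite mulrAC ler_pdivlMr//; lra.
- by rewrite max_l ?leey// gt0_muley// gt0_mulye ?lte_fin ?invr_gt0.
Qed.

Lemma fine_beta_le (b : R) (x y : S) : (beta P X Y x y <= b%:E)%E ->
  fine (beta P X Y x y) <= b.
Proof.
move=> bb; rewrite -lee_fin fineK//.
apply: integrable_fin_num => //; apply: coupling_integrable_dist => //.
by rewrite (le_lt_trans bb) ?ltry.
Qed.

Lemma coupling_expectation_diag (F : R -> R) (x : S) :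
    nondecreasing_fun F -> F 0 = 0 -> P (x, x) [set w | X w = Y w] = 1%E ->
  coupling_expectation P x x (fun w => F (mdist (X w : S) (Y w : S))) = 0%E.
Proof.
move=> F_nd F0 diag; have mZ := measurable_coupled_dist X Y S_separable.
have mE : measurable [set w | X w = Y w].
  have := mZ measurableT _ (measurable_set1 0); rewrite setTI.
  congr measurable; apply/seteqP; split=> w /=; first exact: mdist_positivity.
  by rewrite /coupled_dist => ->; rewrite mdistxx.
apply: (@integral_eq0_almost_surely R dO Omega (P (x, x)) _ _ [set w | X w = Y w]) => //.
- exact: prob_kernel.
- apply: (measurableT_comp (nondecreasing_measurable _ F_nd)) => //.
- by move=> w /= XY; rewrite XY mdistxx.
Qed.

End coupling_theory.

(** * The contraction *)

Theorem theorem2p5 (R : realType) (S : pmetricType R)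
    (S_separable : separable S)
    (dO : measure_display) (Omega : measurableType dO)
    (p : R.-pker (borel S) ~> (borel S))
    (P : R.-pker (borel S * borel S) ~> Omega)
    (X Y : {mfun Omega >-> borel S})
    (coupling : is_markov_coupling p P X Y)
    (diagonal : forall x : S, P (x, x) [set w | X w = Y w] = 1%E)
    (Psi : R -> R) (Psi_adm : admissible_Psi Psi)
    (l0 r1 c0 : R) (l0_gt0 : 0 < l0) (r1_gt0 : 0 < r1) (c0_gt0 : 0 < c0)
    (b1 : (0 < ereal_inf
             [set alpha_low P X Y l0 r / r%:E | r in small_dist S r1])%E)
    (b2 : (c_const P X Y Psi l0 r1 * (Psi l0)%:E <= (ln 2)%:E)%E)
    (b3 : forall r : R, attained_dist S r -> r1 < r ->
            (beta_bar P X Y r <= (- c0 * r)%:E)%E) :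
  let c := fine (c_const P X Y Psi l0 r1) in
  let rho (x y : S) := f3 Psi l0 r1 c (mdist x y) in
  exists c_star : R, 0 < c_star < 1 /\
    forall x y : S,
      (coupling_expectation P x y (fun w => rho (X w) (Y w))
         <= ((1 - c_star) * rho x y)%:E)%E.
Proof.
move=> c rho.
have [cfin c_ge1] := c_const_fin_num _ _ _ _ (admissible_gt0 Psi_adm _ l0_gt0) b2.
rewrite -/c in c_ge1.
have c_ge0 : 0 <= c by lra.
have cPsi : c * Psi l0 <= ln 2 by rewrite -lee_fin EFinM fineK.
have [kappa kappa_gt0 alphaP] := alpha_low_ge_linear S_separable _ _ b1.
pose d1 := f3_d1 Psi l0 r1 c.
have d1_gt0 : 0 < d1 := f3_d1_gt0.
have a_gt0 : 0 < r1 + l0 by exact: addr_gt0.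
pose D1 := derive1 Psi (r1 + l0).
have D1_gt0 : 0 < D1 by exact: admissible_derive1_gt0.
have F_nd := f3_ndecr Psi_adm l0_gt0 r1_gt0 c_ge0.
have F_ge0 := f3_ge0 Psi_adm l0_gt0 r1_gt0 c_ge0.
have F0 : f3 Psi l0 r1 c 0 = 0 by exact: f30.
(* Contraction rates obtained for [r <= r1] and for [r > r1]; the 4 in the
   first is a 2 from [d1 / 2 <= f' r] and a 2 from the excess 1 / 2 in [c / 2]. *)
pose near := d1 * D1 * kappa / 4.
pose far := d1 * c0 / 2.
have near_gt0 : 0 < near by rewrite divr_gt0// !mulr_gt0.
have far_gt0 : 0 < far by rewrite divr_gt0// mulr_gt0.
pose cs := Num.min (2^-1) (Num.min near far).
have cs_half : cs <= 2^-1 by rewrite ge_min lexx.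
have cs_near : cs <= near by rewrite !ge_min lexx orbT.
have cs_far : cs <= far by rewrite !ge_min lexx !orbT.
have cs_gt0 : 0 < cs by rewrite !lt_min near_gt0 far_gt0 invr_gt0 ltr0n.
exists cs; split; first by rewrite cs_gt0/=; lra.
move=> x y; rewrite /rho.
have [r0|r_gt0] := eqVneq (mdist x y) 0.
  have <- := mdist_positivity _ _ r0.
  rewrite (coupling_expectation_diag S_separable) ?diagonal//.
  by rewrite mdistxx F0 mulr0.
have {}r_gt0 : 0 < mdist x y by rewrite lt_neqAle eq_sym r_gt0 mdist_ge0.
have F_le := f3_le_id Psi_adm l0_gt0 r1_gt0 c_ge0 _ (ltW r_gt0).
have g_ge := f3_slope_ge Psi_adm l0_gt0 r1_gt0 c_ge0 (mdist x y).
have beta_le : (beta P X Y x y <= beta_bar P X Y (mdist x y))%E.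
  by apply: ereal_sup_ubound; exists x, y.
move: (F_ge0 (mdist x y)) F_le g_ge.
set r := mdist x y; set Fr := f3 _ _ _ _ r; set g := f3_slope r => Fr_ge0 F_le g_ge.
have [r_le|r_gt] := leP r r1; last first.
  (* Far from the diagonal the tangent inequality suffices. *)
  have b_le : (beta P X Y x y <= (- c0 * r)%:E)%E.
    by apply: le_trans beta_le _; apply: b3 => //; exists x, y.
  apply: le_trans (coupling_expectation_le S_separable _ g 0 l0 _ _ F_nd F_ge0 _ _) _.
  - by rewrite (le_lt_trans b_le)// ltry.
  - move=> z z0; rewrite mul0r mul0r addr0; exact: f3_le_tangent.
  rewrite mul0r addr0 lee_fin.
  have g_ge0 : 0 <= g by rewrite (le_trans _ g_ge)// divr_ge0// ltW.
  have h1 := ler_wpM2l g_ge0 (fine_beta_le S_separable _ _ _ b_le).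
  have h2 : d1 / 2 * (c0 * r) <= g * (c0 * r).
    by rewrite ler_wpM2r// mulr_ge0 ?ltW.
  have h3 : far * Fr <= far * r by rewrite ler_wpM2l// ltW.
  have h4 : cs * Fr <= far * Fr by rewrite ler_wpM2r.
  move: h1 h2 h3 h4; rewrite /far -/r -/Fr; set b := fine (beta _ _ _ _ _); lra.
have [afin kappa_le] : alpha_low P X Y l0 r \is a fin_num /\
    kappa * r <= fine (alpha_low P X Y l0 r) by apply: alphaP; rewrite r_gt0.
have rl0_gt0 : 0 < r + l0 by rewrite addr_gt0.
have dPsir_gt0 := admissible_derive1_gt0 Psi_adm _ rl0_gt0.
have alow_gt0 : 0 < fine (alpha_low P X Y l0 r).
  by rewrite (lt_le_trans _ kappa_le)// mulr_gt0.
have r_small : small_dist S r1 r.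
  by split; [exists x, y|rewrite /= in_itv/= r_gt0].
have b_le := le_trans beta_le (beta_bar_le _ _ _ _ r_small dPsir_gt0 afin alow_gt0 cfin).
pose e := expR (- c * Psi (r + l0)).
pose m := - c * derive1 Psi (r + l0) * e.
apply: le_trans (coupling_expectation_le S_separable _ g m l0 _ _ F_nd F_ge0 _ _) _.
- by rewrite (le_lt_trans b_le)// ltry.
(* The quadratic gain is available below [r + l0] only; above, concavity. *)
- move=> z z0; rewrite indicE; case: (boolP (z \in _)) => [|_].
    rewrite inE/= => zr; rewrite mulr1.
    by apply: f3_le_taylor2; rewrite // ?r_gt0// z0 ltW.
  by rewrite !mulr0 addr0; exact: f3_le_tangent.
rewrite lee_fin.
have {}b_le := fine_beta_le S_separable _ _ _ b_le.
have al_le : fine (alpha_low P X Y l0 r) <= fine (alpha P X Y l0 x y).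
  rewrite fine_le// ?alpha_fin_num//.
  by apply: ereal_inf_lbound; exists x, y.
have e_ge : g / 2 <= e by apply: f3_slope_shift; rewrite // r_gt0.
have D_ge : D1 <= derive1 Psi (r + l0).
  by apply: admissible_derive1_nincr => //; rewrite lerD2r.
move: b_le al_le kappa_le D_ge dPsir_gt0 alow_gt0; rewrite /m -/c -/r -/Fr.
set b := fine (beta _ _ _ _ _); set al := fine (alpha _ _ _ _ _ _).
set a := fine _; set D := derive1 Psi (r + l0).
move=> b_le al_le kappa_le D_ge D_gt0 alow_gt0.
have g_ge0 : 0 <= g by rewrite (le_trans _ g_ge)// divr_ge0// ltW.
have h1 := ler_wpM2l g_ge0 b_le.
(* [h1] and [h2] leave [- g * D * a / 2], which [h3] compares with [Fr]. *)
have h2 : c * D * (g / 2) * a <= c * D * e * al.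
  have cD : 0 <= c * D by rewrite mulr_ge0// ltW.
  by rewrite ler_pM ?(ltW alow_gt0)// ?ler_wpM2l// mulr_ge0// divr_ge0.
have h3 : d1 / 2 * D1 * (kappa * Fr) <= g * D * a.
  rewrite ler_pM ?mulr_ge0 ?divr_ge0 ?(ltW d1_gt0) ?(ltW D1_gt0) ?(ltW kappa_gt0)//.
    by rewrite ler_pM ?divr_ge0 ?(ltW d1_gt0) ?(ltW D1_gt0).
  by rewrite (le_trans _ kappa_le)// ler_wpM2l// ltW.
have h4 : cs * Fr <= near * Fr by rewrite ler_wpM2r.
move: h1 h2 h3 h4; rewrite /near; lra.
Qed.
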